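(* Let $\{G_\alpha:\alpha\in A\}$ be a family of non-trivial topological groups. If the cardinal $\mathrm{Card}(A)$ is $g$-sequential, then the product $G=\prod_{\alpha\in A}G_\alpha$ is not a $g$-sequential topological group.
   Context: Topological groups are assumed Hausdorff. A group is trivial if it consists of one point. A topological group $G$ is $g$-sequential if for every topological group $H$, every sequentially continuous homomorphism $f:G\to H$ is continuous (equivalently, $G$ admits no strictly finer group topology with the same convergent sequences). For a set $E$ let $P(E)$ be the set of all subsets of $E$. A subadditive measure on $E$ is a function $p:P(E)\to[0,1]$ which is monotone ($A\subset B$ implies $p(A)\le p(B)$) and such that: (1) $p(A\cup B)\le p(A)+p(B)$ for all $A,B\in P(E)$ with $A\cap B=\emptyset$; (2) for every decreasing sequence $A_1\supset A_2\supset\dots$ in $P(E)$ with $\bigcap_n A_n=\emptyset$ we have $\lim_n p(A_n)=0$. A cardinal $\tau=\mathrm{Card}(E)$ is $g$-sequential if there is a subadditive measure $p$ on $E$ such that $p(E)=1$ and $p(F)=0$ for all finite subsets $F\subset E$. *)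

(* Defs.v *)
From HB Require Import structures.
From mathcomp Require Import all_boot all_order all_algebra.
From mathcomp Require Import all_classical all_reals all_analysis.

Set Implicit Arguments.
Unset Strict Implicit.
Unset Printing Implicit Defensive.

Import Order.TTheory GRing.Theory Num.Theory.
Import numFieldNormedType.Exports.

Local Open Scope classical_set_scope.
Local Open Scope ring_scope.

HB.structure Definition PreTopologicalGroup :=
  {G of Topological G & Group G}.

HB.mixin Record PreTopologicalGroup_isTopologicalGroup G
    & PreTopologicalGroup G := {
  mulg_continuous : continuous (fun z : G * G => (z.1 * z.2)%g) ;
  invg_continuous : continuous (fun x : G => x^-1%g) ;
  topological_group_hausdorff : hausdorff_space G
}.

(* Topological groups are Hausdorff by convention, and not assumed abelian. *)
#[short(type="topologicalGroupType")]
HB.structure Definition TopologicalGroup :=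
  {G of PreTopologicalGroup G & PreTopologicalGroup_isTopologicalGroup G}.

Section ProductGroup.
Context {I : Type} (G : I -> topologicalGroupType).

Local Notation prodG := (prod_topology G).

Definition prodg_one : prodG := fun i => 1%g.
Definition prodg_mul (x y : prodG) : prodG := fun i => (x i * y i)%g.
Definition prodg_inv (x : prodG) : prodG := fun i => ((x i)^-1)%g.

Lemma prodg_mulA : associative prodg_mul.
Proof. by move=> x y z; apply: functional_extensionality_dep => i; exact: mulgA. Qed.

Lemma prodg_mul1 : left_id prodg_one prodg_mul.
Proof. by move=> x; apply: functional_extensionality_dep => i; exact: mul1g. Qed.

Lemma prodg_mulr1 : right_id prodg_one prodg_mul.
Proof. by move=> x; apply: functional_extensionality_dep => i; exact: mulg1. Qed.

Lemma prodg_mulV : left_inverse prodg_one prodg_inv prodg_mul.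
Proof. by move=> x; apply: functional_extensionality_dep => i; exact: mulVg. Qed.

Lemma prodg_mulrV : right_inverse prodg_one prodg_inv prodg_mul.
Proof. by move=> x; apply: functional_extensionality_dep => i; exact: mulgV. Qed.

HB.instance Definition _ := isGroup.Build prodG
  prodg_mulA prodg_mul1 prodg_mulr1 prodg_mulV prodg_mulrV.

Let cvg_prodg (F : set_system prodG) (x : prodG) : Filter F ->
  (forall i, y i @[y --> F] --> x i) -> F --> x.
Proof.
move=> FF Fx; apply/cvg_sup => i A /= [_ [[B Bop <-] Bx sBA]].
have FB : F ((fun y : prodG => y i) @^-1` B).
  by apply: (Fx i); exact: (open_nbhs_nbhs (conj Bop Bx)).
by apply: filterS FB => y; exact: sBA.
Qed.

Let prodg_proj_continuous i : continuous (fun x : prodG => x i).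
Proof.
pose E : eqType := HB.pack I (gen_eqMixin I).
exact: (@proj_continuous E G i).
Qed.

Lemma prodg_mul_continuous :
  continuous (fun z : prodG * prodG => (z.1 * z.2)%g).
Proof.
move=> z; apply: cvg_prodg => i.
apply: (@continuous_comp _ _ _ (fun z : prodG * prodG => (z.1 i, z.2 i))
  (fun z : G i * G i => (z.1 * z.2)%g)); last exact: mulg_continuous.
apply: cvg_pair => /=.
  apply: (@continuous_comp _ _ _ fst (fun x : prodG => x i)).
    exact: cvg_fst.
  exact: prodg_proj_continuous.
apply: (@continuous_comp _ _ _ snd (fun x : prodG => x i)).
  exact: cvg_snd.
exact: prodg_proj_continuous.
Qed.

Lemma prodg_inv_continuous : continuous (fun x : prodG => x^-1%g).
Proof.
move=> x; have FF : Filter ((fun y : prodG => y^-1%g) @ x).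
  exact: (@fmap_filter _ _ _ _ (@nbhs_filter prodG x)).
apply: cvg_prodg => i.
apply: (@continuous_comp _ _ _ (fun x : prodG => x i)
  (fun x : G i => x^-1%g)); last exact: invg_continuous.
exact: prodg_proj_continuous.
Qed.

Lemma prodg_hausdorff : hausdorff_space prodG.
Proof.
pose E : eqType := HB.pack I (gen_eqMixin I).
apply: (@hausdorff_product E G) => i.
exact: topological_group_hausdorff.
Qed.

HB.instance Definition _ := PreTopologicalGroup_isTopologicalGroup.Build prodG
  prodg_mul_continuous prodg_inv_continuous prodg_hausdorff.

End ProductGroup.

Definition trivial_group (G : topologicalGroupType) : Prop :=
  exists x : G, [set: G] = [set x].

Definition seq_continuous (X Y : topologicalType) (f : X -> Y) : Prop :=
  forall (u : nat -> X) (l : X),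
    u n @[n --> \oo] --> l -> f (u n) @[n --> \oo] --> f l.

Definition g_sequential (G : topologicalGroupType) : Prop :=
  forall (H : topologicalGroupType) (f : {multiplicative G -> H}),
    seq_continuous f -> continuous f.

Record subadditive_measure (R : realType) (E : Type) (p : set E -> R) : Prop :=
  SubadditiveMeasure {
    subadditive_measure_itv : forall B : set E, 0 <= p B <= 1 ;
    subadditive_measure_le : forall B C : set E, B `<=` C -> p B <= p C ;
    subadditive_measureU : forall B C : set E,
      B `&` C = set0 -> p (B `|` C) <= p B + p C ;
    subadditive_measure_cvg0 : forall B : nat -> set E,
      nonincreasing_seq B -> \bigcap_n B n = set0 ->
      p (B n) @[n --> \oo] --> (0 : R)
  }.

(* "Card E is g-sequential": the property is invariant under bijections, so it
   is stated on a representative E of the cardinal. *)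
Definition g_sequential_card (R : realType) (E : Type) : Prop :=
  exists p : set E -> R, [/\ subadditive_measure p,
    p [set: E] = 1 &
    forall F : set E, finite_set F -> p F = 0].

(* Main.v *)
From HB Require Import structures.
Require Import Defs.
From mathcomp Require Import all_boot all_order all_algebra.
From mathcomp Require Import all_classical all_reals all_analysis.

(** The same group [prod_topology G] carries a strictly finer Hausdorff group
    topology with the same convergent sequences, so that the identity map
    violates g-sequentiality.  Given the subadditive measure [p] on the index
    set, a neighbourhood of [x] in the finer topology contains all [y] that lie
    in a product neighbourhood of [x] and satisfy [y a] \in [U a] for all
    indices [a] outside a set of [p]-measure < [e], for some
    [e > 0] and some neighbourhood [U a] of [x a] chosen freely for each [a].

    The freedom to choose [U a] separately at each index is what makes the
    group operations continuous even if the groups are not abelian: continuity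
    is applied in each factor, and the exceptional sets of the two arguments
    add up by subadditivity ([mulg_submeasure_continuous]).  The product
    neighbourhoods only serve to keep the topology Hausdorff.

    If [u n] tends to [l] in the product, the set of indices [a] at which
    [u m a] still leaves [U a] for some [m >= n] decreases to the empty set as
    [n] grows, hence its measure tends to 0; so [u n] tends to [l] in the finer
    topology as well ([submeasure_cvg_seq]).  The topology is strictly finer
    because a product neighbourhood of 1 restricts only finitely many
    coordinates ([nbhs_prod_topology_finite]): it contains a point that is
    different from 1 off a finite set, which [p] does not charge, whereas in
    the finer topology a point near 1 may avoid given neighbourhoods of 1 only
    on a set of small measure. *)

Set Implicit Arguments.
Unset Strict Implicit.
Unset Printing Implicit Defensive.

Import Order.TTheory GRing.Theory Num.Theory.
Import numFieldNormedType.Exports.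

Local Open Scope classical_set_scope.
Local Open Scope ring_scope.

(** * Subadditive measures *)

Lemma subadditive_measure_setU (R : realType) (E : Type) (p : set E -> R)
    (B C : set E) :
  subadditive_measure p -> p (B `|` C) <= p B + p C.
Proof.
move=> pm; have -> : B `|` C = B `|` (C `\` B) by rewrite setUDr setDv setD0.
apply: (le_trans (subadditive_measureU pm _)).
  by rewrite setDE setIC -setIA setICl setI0.
by rewrite lerD2l; apply: (subadditive_measure_le pm) => a [].
Qed.

(** This is forced by continuity along the constant sequence of empty sets;
    subadditivity by itself only gives a lower bound. *)
Lemma subadditive_measure_set0 (R : realType) (E : Type) (p : set E -> R) :
  subadditive_measure p -> p set0 = 0.
Proof.
move=> pm; have p0 : p set0 @[n --> \oo] --> (0 : R).
  apply: (subadditive_measure_cvg0 pm) => //.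
  by rewrite bigcap_const//; exists 0%N.
exact: (cvg_unique _ (cvg_cst _) p0).
Qed.

(** * Neighbourhoods in the product topology *)

Section ProductTopology.
Context {I : Type} (T : I -> topologicalType).
Implicit Types x y : prod_topology T.

Lemma prod_topology_proj_continuous i :
  continuous (fun x : prod_topology T => x i).
Proof.
(* Equality on any index type is classically decidable. *)
pose E : eqType := HB.pack I (gen_eqMixin I).
exact: (@proj_continuous E T i).
Qed.

(** The sets containing all points that agree with [x] on some finite set of
    coordinates form a filter, and this filter converges to [x] because it does
    so in each coordinate.  Hence it contains every neighbourhood of [x]. *)
Lemma nbhs_prod_topology_finite x (S : set (prod_topology T)) : nbhs x S ->
  exists2 F : set I, finite_set F &
    forall y, (forall i, F i -> y i = x i) -> S y.
Proof.
pose agree : set_system (prod_topology T) := fun S' =>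
  exists2 F : set I, finite_set F &
    forall y, (forall i, F i -> y i = x i) -> S' y.
have agreeF : Filter agree.
  split; first by exists set0.
    move=> B C [F finF FB] [F' finF' FC].
    exists (F `|` F'); first by rewrite finite_setU.
    by move=> y yx; split; [apply: FB|apply: FC] => i Fi; apply: yx;
      [left|right].
  by move=> B C sBC [F finF FB]; exists F => // y /FB /sBC.
have : agree --> x.
  apply/cvg_sup => i B /= [_ [[C Cop <-] Cx sCB]].
  exists [set i]; first exact: finite_set1.
  by move=> y yx; apply: sCB => /=; rewrite (yx i).
exact.
Qed.

End ProductTopology.

(** * Convergence up to small exceptional sets *)

Section SubmeasureTopology.
Context {R : realType} {I : Type} (p : set I -> R).
Context (pm : subadditive_measure p).

Section Topology.
Context (T : I -> topologicalType).

Definition exceptional (U : forall i, set (T i)) (x : prod_topology T) :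
    set I :=
  [set i | ~ U i (x i)].

Definition submeasure_nbhs (x : prod_topology T) :
    set_system (prod_topology T) :=
  [set S | exists N : set (prod_topology T), exists U : forall i, set (T i),
    exists e : R, [/\ nbhs x N, (forall i, nbhs (x i) (U i)), 0 < e &
      forall y, N y -> p (exceptional U y) < e -> S y]].

Lemma exceptional_nbhs (U : forall i, set (T i)) (x : prod_topology T) :
  (forall i, nbhs (x i) (U i)) -> p (exceptional U x) = 0.
Proof.
move=> Ux; suff -> : exceptional U x = set0.
  exact: subadditive_measure_set0 pm.
by apply/seteqP; split=> // i; apply; apply: nbhs_singleton (Ux i).
Qed.

Lemma submeasure_nbhs_filter x : ProperFilter (submeasure_nbhs x).
Proof.
apply: Build_ProperFilter_ex.
  move=> S [N [U [e [Nx Ux e0]]]] /(_ x) Sx; exists x.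
  by apply: Sx; [exact: nbhs_singleton Nx|rewrite exceptional_nbhs].
split.
- exists setT, (fun=> setT), 1; split=> //; first exact: filterT.
  by move=> i; exact: filterT.
- move=> B C [N [U [e [Nx Ux e0 NUB]]]] [N' [U' [e' [Nx' Ux' e0' NUC]]]].
  exists (N `&` N'), (fun i => U i `&` U' i), (Num.min e e'); split.
  + exact: filterI.
  + by move=> i; exact: filterI.
  + by rewrite lt_min e0.
  + move=> y [Ny N'y]; rewrite lt_min => /andP[ye ye'].
    split; [apply: NUB => //|apply: NUC => //].
      by apply: le_lt_trans ye; apply: (subadditive_measure_le pm) => i Ui [].
    by apply: le_lt_trans ye'; apply: (subadditive_measure_le pm) => i Ui [].
- move=> B C sBC [N [U [e [Nx Ux e0 NUB]]]].
  by exists N, U, e; split=> // y Ny ye; apply: sBC; exact: NUB.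
Qed.

Lemma submeasure_nbhs_singleton x S : submeasure_nbhs x S -> S x.
Proof.
move=> [N [U [e [Nx Ux e0]]]]; apply; first exact: nbhs_singleton.
by rewrite exceptional_nbhs.
Qed.

Lemma submeasure_nbhs_nbhs x S :
  submeasure_nbhs x S -> submeasure_nbhs x (submeasure_nbhs^~ S).
Proof.
move=> [N [U [e [Nx Ux e0 NUS]]]].
exists (nbhs^~ N), (fun i => nbhs^~ (U i)), e; split=> //.
- exact: nbhs_interior.
- by move=> i; exact: nbhs_interior.
move=> y Ny ye; set K := exceptional _ y in ye.
(* On the exceptional set K of y nothing is asked of z: its measure is already
   counted, and the slack e - p K is left for the other indices. *)
exists N, (fun i => [set t | K i \/ U i t]), (e - p K); split=> //.
- move=> i; have [Ki|/contrapT Ui] := pselect (K i).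
    by apply: filterS filterT => t _; left.
  by apply: filterS Ui => t; right.
- by rewrite subr_gt0.
move=> z Nz ze; apply: NUS => //; rewrite ltrBrDl in ze.
apply: le_lt_trans ze; apply: le_trans (subadditive_measure_setU _ _ pm).
apply: (subadditive_measure_le pm) => i Uz.
by have [Ki|nKi] := pselect (K i); [left|right=> -[]].
Qed.

(** A separate type constant, indexed by [pm], prevents the finer topology from
    competing with the product topology on the same carrier. *)
Definition submeasure_topology of subadditive_measure p : Type :=
  prod_topology T.

HB.instance Definition _ := Choice.copy (submeasure_topology pm)
  (prod_topology T).
HB.instance Definition _ := hasNbhs.Build (submeasure_topology pm)
  submeasure_nbhs.
HB.instance Definition _ := Nbhs_isNbhsTopological.Build
  (submeasure_topology pm) submeasure_nbhs_filter submeasure_nbhs_singleton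
  submeasure_nbhs_nbhs.

Lemma submeasure_prod_continuous :
  continuous (idfun : submeasure_topology pm -> prod_topology T).
Proof.
move=> x N Nx; exists N, (fun=> setT), 1; split=> // i; exact: filterT.
Qed.

(** Since [U] is fixed before [n], the sets of indices at which the tail of the
    sequence from [n] on leaves [U] decrease to the empty set, and their
    measure tends to 0. *)
Lemma submeasure_cvg_seq (u : nat -> prod_topology T) (l : prod_topology T) :
  u n @[n --> \oo] --> l ->
  (u n : submeasure_topology pm) @[n --> \oo] --> (l : submeasure_topology pm).
Proof.
move=> ul S [N [U [e [Nl Ul e0 NUS]]]].
pose B n : set I := [set i | exists2 m, (n <= m)%N & ~ U i (u m i)].
have B0 : p (B n) @[n --> \oo] --> (0 : R).
  apply: (subadditive_measure_cvg0 pm).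
    move=> m n mn; rewrite subsetEset => i [k nk Uk].
    by exists k => //; exact: leq_trans nk.
  apply/seteqP; split=> // i Bi.
  have [n _ nU] : \forall n \near \oo, U i (u n i).
    apply: (ul ((fun x : prod_topology T => x i) @^-1` U i)).
    exact: prod_topology_proj_continuous (Ul i).
  by have [m nm] := Bi n Logic.I; apply; exact: nU.
suff : \forall n \near \oo, S (u n) by [].
near=> n; apply: NUS; first by near: n; exact: (ul N Nl).
apply: (@le_lt_trans _ _ (p (B n))).
  by apply: (subadditive_measure_le pm) => i Ui; exists n.
by near: n; exact: (cvgr_lt 0 B0 e e0).
Unshelve. all: by end_near. Qed.

End Topology.

(** * The finer group topology on a product of groups *)

Section Group.
Context (G : I -> topologicalGroupType).

HB.instance Definition _ := Group.copy (submeasure_topology G pm)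
  (prod_topology G).

Local Notation H := (submeasure_topology G pm).

(** At each index separately, continuity of the product gives a pair [V i] of
    neighbourhoods of [x i] and [y i] whose product set lies in [U i]; the
    product of two points is then exceptional only where one of its factors
    is. *)
Lemma mulg_submeasure_continuous : continuous (fun z : H * H => (z.1 * z.2)%g).
Proof.
move=> [x y] S [N [U [e [Nxy Uxy e0 NUS]]]].
have [[N1 N2] [/= N1x N2y] N12] :=
  @mulg_continuous (prod_topology G) (x, y) N Nxy.
have exV i : exists V : set (G i) * set (G i),
    [/\ nbhs (x i) V.1, nbhs (y i) V.2 &
      forall s t, V.1 s -> V.2 t -> U i (s * t)%g].
  have [V [Vx Vy] sVU] := @mulg_continuous (G i) (x i, y i) (U i) (Uxy i).
  by exists V; split=> // s t Vs Vt; exact: (sVU (s, t)).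
pose V i := sval (cid (exV i)); have VU i : [/\ nbhs (x i) (V i).1,
    nbhs (y i) (V i).2 & forall s t, (V i).1 s -> (V i).2 t -> U i (s * t)%g].
  exact: svalP (cid (exV i)).
have e20 : 0 < e / 2 by rewrite divr_gt0.
exists ([set s | N1 s /\ p (exceptional (fun i => (V i).1) s) < e / 2],
        [set t | N2 t /\ p (exceptional (fun i => (V i).2) t) < e / 2]).
  split.
    exists N1, (fun i => (V i).1), (e / 2); split=> // i.
    by have [] := VU i.
  exists N2, (fun i => (V i).2), (e / 2); split=> // i.
  by have [] := VU i.
move=> [s t] [/= [N1s Vs] [N2t Vt]]; apply: NUS; first exact: (N12 (s, t)).
rewrite [e]splitr; apply: le_lt_trans (ltrD Vs Vt).
apply: le_trans (subadditive_measure_setU _ _ pm).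
apply: (subadditive_measure_le pm) => i Ust; apply: contrapT => /not_orP.
by move=> [/contrapT Vsi /contrapT Vti]; apply: Ust; have [_ _] := VU i; apply.
Qed.

Lemma invg_submeasure_continuous : continuous (fun x : H => x^-1%g).
Proof.
move=> x S [N [U [e [Nx Ux e0 NUS]]]].
exists ((fun y : prod_topology G => y^-1%g) @^-1` N),
  (fun i => (fun t : G i => t^-1%g) @^-1` U i), e; split=> //.
- exact: (@invg_continuous (prod_topology G) x N Nx).
- by move=> i; exact: (@invg_continuous (G i) (x i) (U i) (Ux i)).
- by move=> y Ny ye; exact: NUS.
Qed.

Lemma submeasure_hausdorff : hausdorff_space H.
Proof.
move=> x y xy; apply: (@topological_group_hausdorff (prod_topology G)).
move=> B C Bx Cy; apply: xy; exact: submeasure_prod_continuous.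
Qed.

HB.instance Definition _ := PreTopologicalGroup_isTopologicalGroup.Build
  (submeasure_topology G pm) mulg_submeasure_continuous
  invg_submeasure_continuous submeasure_hausdorff.

Definition prod_to_submeasure : prod_topology G -> H := idfun.

Let prod_to_submeasureM : {morph prod_to_submeasure : x y / (x * y)%g}.
Proof. by []. Qed.

HB.instance Definition _ := isMultiplicative.Build (prod_topology G)
  (submeasure_topology G pm) prod_to_submeasure prod_to_submeasureM.

(** With points [x i != 1] and [U i] the complement of [x i], the point equal
    to 1 on a finite set and to [x] elsewhere is exceptional off that finite
    set, thus on a set of full measure. *)
Lemma prod_to_submeasure_not_continuous :
  (forall i, ~ trivial_group (G i)) ->
  p [set: I] = 1 -> (forall F : set I, finite_set F -> p F = 0) ->
  ~ continuous prod_to_submeasure.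
Proof.
move=> Gnt pT pF /(_ 1%g) idC.
have exx i : exists t : G i, t <> 1%g.
  apply: contrapT => /forallNP G1; apply: (Gnt i); exists 1%g.
  by apply/seteqP; split=> // t _; apply: contrapT => /G1.
pose x i := sval (cid (exx i)); have x1 i : x i <> 1%g := svalP (cid (exx i)).
pose U i : set (G i) := [set t | t <> x i].
have U1 i : nbhs (1%g : G i) (U i).
  apply: open_nbhs_nbhs; split; last by move=> x1i; exact: (x1 i).
  rewrite (_ : U i = ~` [set x i])//.
  apply: closed_openC; apply: accessible_closed_set1.
  exact: hausdorff_accessible (@topological_group_hausdorff (G i)).
have : nbhs (1%g : H) [set y | p (exceptional U y) < 1].
  by exists setT, U, 1; split=> //; exact: filterT.
move=> /idC /nbhs_prod_topology_finite[F finF].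
pose y : prod_topology G := fun i => if pselect (F i) then 1%g else x i.
have Fy i : F i -> y i = 1%g by rewrite /y; case: pselect.
move=> /(_ y Fy) /=; rewrite -pT; apply/negP; rewrite -leNgt.
rewrite -[leRHS](add0r _) -(pF F finF).
apply: le_trans (subadditive_measure_setU _ _ pm).
apply: (subadditive_measure_le pm) => i _.
have [Fi|nFi] := pselect (F i); [by left|right].
have yx : y i = x i by rewrite /y; case: pselect.
by rewrite /exceptional /= => /(_ yx).
Qed.

End Group.
End SubmeasureTopology.

Theorem proposition3p3 (R : realType) (A : Type)
    (G : A -> topologicalGroupType)
    (G_nontrivial : forall a : A, ~ trivial_group (G a))
    (A_g_sequential : g_sequential_card R A) :
  ~ g_sequential (prod_topology G).
Proof.
have [p [pm pT pF]] := A_g_sequential => Gseq.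
apply: (@prod_to_submeasure_not_continuous _ _ _ pm G G_nontrivial pT pF).
apply: (Gseq _ (@prod_to_submeasure _ _ _ pm G)) => u l.
exact: submeasure_cvg_seq.
Qed.
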